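(* Let $\mathbb{C}$ be a finite disjoint union of cycles with set of cycle lengths $C$, and let $D\subset\mathbb{N}^+$ be a finite nonempty set. Then $\operatorname{Pol}(\mathbb{C})\models\Sigma_D$ if and only if for all maps $h\colon D\to C$ there is an $a\in C$ such that \[a\ \text{ divides }\ \operatorname{lcm}(\{h(b)\mathbin{\dot{\div}} b\mid b\in D\}).\]
   Context: A finite disjoint union of cycles is a finite nonempty digraph $\mathbb{C}$ all of whose connected components are directed cycles (a loop is a directed cycle of length 1); $C$ is the set of $a\in\mathbb{N}^+$ such that $\mathbb{C}$ contains a cycle of length $a$ as a component. For $a,c\in\mathbb{N}^+$ put $a\mathbin{\dot{\div}} c=a/\gcd(a,c)$. $\operatorname{Pol}(\mathbb{C})$ is the set of all homomorphisms $\mathbb{C}^n\to\mathbb{C}$, $n\geq1$. For a finite nonempty $D\subset\mathbb{N}^+$ let $V_D=\{(b,k)\mid b\in D,k\in\mathbb{Z}_b\}$ and $\sigma_D\colon V_D\to V_D$, $(b,k)\mapsto(b,k+1)$. $\operatorname{Pol}(\mathbb{C})\models\Sigma_D$ means that there is a homomorphism $f\colon\mathbb{C}^{V_D}\to\mathbb{C}$ (i.e. a polymorphism of $\mathbb{C}$ of arity $|V_D|$ with arguments indexed by $V_D$) such that $f(t)=f(t\circ\sigma_D)$ for all $t\in\mathbb{C}^{V_D}$. *)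

(* Defs.v *)
From HB Require Import structures.
From mathcomp Require Import all_boot finmap.

Set Implicit Arguments.
Unset Strict Implicit.
Unset Printing Implicit Defensive.

(** A finite digraph is a relation [e : rel V] on a [finType] of vertices. *)

Section Digraphs.
Variables (V : finType) (e : rel V).

(** Connected components are taken in the underlying undirected graph. *)
Definition component (x : V) : {set V} :=
  [set y | connect [rel u v | e u v || e v u] x y].

(** The subgraph induced on [A] is isomorphic, via [phi], to the digraph on
    Z_a with edges k -> k + 1; [ordS] is the successor modulo [a]. *)
Definition is_dicycle (A : {set V}) (a : nat) : Prop :=
  0 < a /\
  exists phi : 'I_a -> V,
    [/\ injective phi,
        [set phi i | i : 'I_a] = A &
        forall i j : 'I_a, e (phi i) (phi j) = (j == ordS i)].

Definition disjoint_union_of_cycles : Prop :=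
  0 < #|V| /\ forall x : V, exists a : nat, is_dicycle (component x) a.

(** The set C of cycle lengths. *)
Definition cycle_length (a : nat) : Prop :=
  exists x : V, is_dicycle (component x) a.

End Digraphs.

Definition dihom (G H : finType) (eG : rel G) (eH : rel H) (f : G -> H) : Prop :=
  forall x y : G, eG x y -> eH (f x) (f y).

(** Edge relation of the power digraph, with arguments indexed by [X]. *)
Definition power_edge (X V : finType) (e : rel V) : rel {ffun X -> V} :=
  fun s t => [forall x, e (s x) (t x)].

(** For [b > 0], [ 'I_b ] with [ordS] is Z_b with k |-> k + 1. *)
Definition VD (D : {fset nat}) : finType := {b : D & 'I_(val b)}.

Definition sigmaD (D : {fset nat}) (v : VD D) : VD D :=
  Tagged (fun b : D => 'I_(val b)) (ordS (tagged v)).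

Definition Pol_models_Sigma (V : finType) (e : rel V) (D : {fset nat}) : Prop :=
  exists f : {ffun VD D -> V} -> V,
    dihom (@power_edge (VD D) V e) e f /\
    forall t : {ffun VD D -> V}, f t = f [ffun v => t (sigmaD v)].

Definition dotdiv (a c : nat) : nat := a %/ gcdn a c.

(* Main.v *)
Require Import Defs.
From mathcomp Require Import all_boot finmap.

(** A disjoint union of cycles is the graph of a permutation [s] of its
    vertices, and its powers are graphs of permutations too. So a polymorphism
    satisfying Sigma_D is an equivariant map out of the power for the shift [S]
    induced by [s], invariant under the rotation [P] of coordinates induced by
    [sigmaD]. As [S] and [P] commute, it exists iff for every tuple [t] some
    vertex [x] is fixed by [s^n] as soon as [S^n P^m t = t] for some [m].
    If [S^n P^m t = t], then iterating [b] times removes the rotation on the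
    block [b], so the length [h b] of the cycle of [t (b, 0)] divides [n b]:
    hence the lcm of the [dotdiv (h b) b] divides [n]. Conversely, with [L] this
    lcm and [x b] on a cycle of length [h b], the tuple [(b, k) |-> s^(L k) (x b)]
    is well defined and satisfies [P t = S^L t], so [s^L] fixes its image. *)

Set Implicit Arguments.
Unset Strict Implicit.
Unset Printing Implicit Defensive.

Lemma dvdn_dotdiv_mul (a c : nat) : a %| dotdiv a c * c.
Proof.
by rewrite -{1}(divnK (dvdn_gcdl a c)) dvdn_mul // dvdn_gcdr.
Qed.

(** After division by the gcd, [c %/ gcdn a c] is coprime to [dotdiv a c] and cancels by Gauss. With
    [dvdn_dotdiv_mul], the multiples of [dotdiv a c] are exactly the [n] with [a %| n * c]. *)
Lemma dotdiv_dvdn (a c n : nat) : 0 < a -> a %| n * c -> dotdiv a c %| n.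
Proof.
move=> a_gt0 a_dvd; have g_gt0 : 0 < gcdn a c by rewrite gcdn_gt0 a_gt0.
rewrite -(@Gauss_dvdl _ _ (c %/ gcdn a c)).
  rewrite -(dvdn_pmul2r g_gt0) -mulnA !divnK ?dvdn_gcdl ?dvdn_gcdr //.
rewrite /coprime -(eqn_pmul2r g_gt0) muln_gcdl mul1n.
by rewrite !divnK ?dvdn_gcdl ?dvdn_gcdr.
Qed.

Lemma iterC (T : Type) (f g : T -> T) (n m : nat) :
  (forall x, f (g x) = g (f x)) ->
  forall x, iter n f (iter m g x) = iter m g (iter n f x).
Proof.
move=> fgC x; have fmC y : f (iter m g y) = iter m g (f y).
  by elim: m => //= m IH; rewrite fgC IH.
by elim: n => //= n ->; rewrite fmC.
Qed.

Lemma iter_inj (T : Type) (f : T -> T) (n : nat) :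
  injective f -> injective (iter n f).
Proof. by move=> f_inj x y; elim: n => //= n IH /f_inj. Qed.

Lemma val_iter_ordS (a n : nat) (i : 'I_a) :
  nat_of_ord (iter n (@ordS a) i) = (i + n) %% a.
Proof.
elim: n => [|n IH] /=; first by rewrite addn0 modn_small.
by rewrite IH -addn1 modnDml addn1 addnS.
Qed.

Lemma iter_ordS_eq (a n : nat) (i : 'I_a) :
  (iter n (@ordS a) i == i) = (a %| n).
Proof.
rewrite -val_eqE /= val_iter_ordS -{2}(modn_small (ltn_ord i)).
by rewrite -{2}[nat_of_ord i]addn0 eqn_modDl mod0n.
Qed.

Section EquivariantMap.
Variables (W V : finType) (S P : W -> W) (s : V -> V).
Hypotheses (S_inj : injective S) (P_inj : injective P).
Hypothesis SPC : forall t, S (P t) = P (S t).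

Let R : rel W := relU (frel S) (frel P).

Lemma connect_shift_rotation (t u : W) :
  connect R t u -> exists n m, u = iter n S (iter m P t).
Proof.
case/connectP=> p + ->; elim: p t => [|v p IH] t /=; first by exists 0, 0.
case/andP=> /orP[] /eqP<- /IH[n [m ->]].
- by exists n.+1, m; rewrite iterSr -(@iterC _ S P 1).
- by exists n, m.+1; rewrite iterSr.
Qed.

(** Injective self-maps of a finite type are permutations, so forward paths can be reversed. The
    classes of [R] are thus the joint orbits of [S] and [P], and [root R] picks one base point in
    each. *)
Lemma connect_shift_rotation_sym : connect_sym R.
Proof. by apply: relU_sym; apply: fconnect_sym. Qed.

(** This makes the assignment of [s^n x] to [S^n P^m r] well defined on the orbit of [r]. *)
Lemma shift_rotation_invariant (r : W) (x : V) :
  (forall n m, iter n S (iter m P r) = r -> iter n s x = x) ->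
  forall n n' m m', iter n S (iter m P r) = iter n' S (iter m' P r) ->
  iter n s x = iter n' s x.
Proof.
move=> fix_x n n' m m'.
wlog le_n : n n' m m' / n <= n'.
  move=> H; case/orP: (leq_total n n') => le_n; first exact: H le_n.
  by move/esym => /(H _ _ _ _ le_n) ->.
(* Cancelling [S^n] leaves [P^m r = S^k P^m' r] with [k = n' - n], and it suffices that [s^k] fixes
   [x]. *)
rewrite -(subnKC le_n) !iterD.
move: (n' - n) => k /(iter_inj S_inj) E.
congr iter; apply/esym.
(* [P^-m] at [r] is [P^(m (o - 1))], where [o] is the order of [P] at [r]. *)
apply: (fix_x k (m * (order P r).-1 + m')).
rewrite iterD iterC // -E -iterD addnC -mulnS prednK ?order_gt0 //.
rewrite mulnC; elim: m {E} => [|m IH]; first by rewrite muln0.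
by rewrite mulnS addnC iterD iter_order.
Qed.

(** On the orbit with root [r], send [S^n P^m r] to [s^n (x r)]. *)
Lemma exists_equivariant_map :
  (forall t, exists x : V,
     forall n m, iter n S (iter m P t) = t -> iter n s x = x) ->
  exists f : W -> V, forall t, f (S t) = s (f t) /\ f (P t) = f t.
Proof.
move/fin_all_exists=> [x fix_x].
have /fin_all_exists[n nP] t : exists n, exists m,
    t = iter n S (iter m P (root R t)).
  apply: connect_shift_rotation.
  by rewrite connect_shift_rotation_sym connect_root.
have same_root t u : R t u -> root R u = root R t.
  by move=> /connect1 /(rootP connect_shift_rotation_sym).
exists (fun t => iter (n t) s (x (root R t))) => t.
have [m tE] := nP t; split.
- have rE : root R (S t) = root R t by apply: same_root; rewrite /R /= eqxx.
  have [m' StE] := nP (S t); rewrite rE in StE *.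
  apply: (@shift_rotation_invariant (root R t) _ (fix_x _) _ (n t).+1 m' m).
  by rewrite -StE iterS -tE.
- have rE : root R (P t) = root R t by apply: same_root; rewrite /R /= eqxx orbT.
  have [m' PtE] := nP (P t); rewrite rE in PtE *.
  apply: (@shift_rotation_invariant (root R t) _ (fix_x _) _ (n t) m' m.+1).
  by rewrite -PtE iterS (@iterC _ S P _ 1) //= -tE.
Qed.

End EquivariantMap.

Section Cycles.
Variables (V : finType) (e : rel V).
Hypothesis He : disjoint_union_of_cycles e.

Lemma disjoint_union_of_cycles_succ :
  exists2 s : V -> V, injective s & forall x y, e x y = (y == s x).
Proof.
have in_comp x y : e x y || e y x -> y \in component e x.
  by move=> exy; rewrite inE connect1.
have comp_refl x : x \in component e x by rewrite inE connect0.
have /fin_all_exists[s sP] x : exists y, forall z, e x z = (z == y).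
  have [a [_ [phi [phi_inj phiA phiE]]]] := He.2 x.
  have := comp_refl x; rewrite -phiA => /imsetP[i _ xE].
  exists (phi (ordS i)) => z; apply/idP/eqP => [exz | ->].
    have: z \in component e x by apply: in_comp; rewrite exz.
    rewrite -phiA => /imsetP[j _ zE].
    by move: exz; rewrite xE zE phiE => /eqP->.
  by rewrite xE phiE.
exists s => // x y sxy.
have [a [_ [phi [phi_inj phiA phiE]]]] := He.2 (s x).
(* Components ignore direction, so every predecessor of [s x] lies on the cycle of [s x], where
   [ordS] is injective. *)
have pred_in z : s z = s x -> exists2 i, z = phi i & s x = phi (ordS i).
  move=> szx.
  have: z \in component e (s x) by apply: in_comp; rewrite orbC sP szx eqxx.
  rewrite -phiA => /imsetP[i _ zE]; exists i => //.
  by apply/esym/eqP; rewrite -szx -sP zE phiE.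
have [i xE Ei] := pred_in x erefl.
have [j yE Ej] := pred_in y (esym sxy).
rewrite xE yE; congr (phi _); apply: (can_inj (@ordSK a)); apply: phi_inj.
by rewrite -Ei.
Qed.

Lemma iter_dicycle_eq (s : V -> V) (x : V) (a n : nat) :
  (forall x y, e x y = (y == s x)) ->
  is_dicycle e (component e x) a -> (iter n s x == x) = (a %| n).
Proof.
move=> sP [_ [phi [phi_inj phiA phiE]]].
have: x \in component e x by rewrite inE connect0.
rewrite -phiA => /imsetP[i _ ->].
have ->: iter n s (phi i) = phi (iter n (@ordS a) i).
  elim: n => //= n ->; apply/esym/eqP.
  by rewrite -sP phiE.
by rewrite (inj_eq phi_inj) iter_ordS_eq.
Qed.

End Cycles.

Section Rotation.
Variables (V : finType) (D : {fset nat}).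

Definition shift (s : V -> V) (t : {ffun VD D -> V}) : {ffun VD D -> V} :=
  [ffun v => s (t v)].

Definition rotation (t : {ffun VD D -> V}) : {ffun VD D -> V} :=
  [ffun v => t (sigmaD v)].

Lemma iter_shift (s : V -> V) n t v : iter n (shift s) t v = iter n s (t v).
Proof. by elim: n => //= n IH; rewrite ffunE IH. Qed.

Lemma iter_rotation n t (b : D) (k : 'I_(val b)) :
  iter n rotation t (Tagged (fun b : D => 'I_(val b)) k) =
  t (Tagged (fun b : D => 'I_(val b)) (iter n (@ordS (val b)) k)).
Proof. by elim: n k => //= n IH k; rewrite ffunE IH -iterSr. Qed.

Lemma shift_rotation s t : shift s (rotation t) = rotation (shift s t).
Proof. by apply/ffunP=> v; rewrite !ffunE. Qed.

Lemma shift_inj s : injective s -> injective (shift s).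
Proof.
move=> s_inj t u /ffunP tu; apply/ffunP=> v.
by have := tu v; rewrite !ffunE => /s_inj.
Qed.

Lemma rotation_inj : injective rotation.
Proof.
move=> t u /ffunP tu; apply/ffunP=> -[b k].
have := tu (Tagged (fun b : D => 'I_(val b)) (ord_pred k)).
by rewrite !ffunE /sigmaD /= ord_predK.
Qed.

Lemma power_edge_shift (e : rel V) s t u :
  (forall x y, e x y = (y == s x)) -> power_edge e t u = (u == shift s t).
Proof.
move=> sP; apply/forallP/eqP => [tu | -> v]; last by rewrite sP ffunE.
by apply/ffunP=> v; apply/eqP; rewrite ffunE -sP.
Qed.

Lemma shift_rotation_block (s : V -> V) n m t (b : D) (k : 'I_(val b)) :
  iter n (shift s) (iter m rotation t) = t ->
  iter (n * val b) s (t (Tagged (fun b : D => 'I_(val b)) k)) =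
  t (Tagged (fun b : D => 'I_(val b)) k).
Proof.
move=> fix_t; set v := Tagged _ k.
(* This is the [j]-th power of [S^n P^m], split by commutation; it is used with [j = val b]. *)
have fix_t_iter j : iter (n * j) (shift s) (iter (m * j) rotation t) = t.
  elim: j => [|j IH]; first by rewrite !muln0.
  rewrite !mulnS addnC iterD iterD.
  rewrite (@iterC _ rotation rotation m (m * j)) //.
  rewrite (@iterC _ (shift s) rotation n (m * j)); last exact: shift_rotation.
  by rewrite fix_t.
rewrite -{2}(fix_t_iter (val b)) iter_shift iter_rotation.
by have /eqP-> : iter (m * val b) (@ordS _) k == k
  by rewrite iter_ordS_eq dvdn_mull.
Qed.

End Rotation.

Theorem lemma6p2 (V : finType) (e : rel V) (D : {fset nat})
    (He : disjoint_union_of_cycles e)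
    (D_neq0 : D <> fset0)
    (D_pos : forall b : nat, b \in D -> 0 < b) :
  Pol_models_Sigma e D <->
  (forall h : D -> nat, (forall b : D, cycle_length e (h b)) ->
     exists a : nat, cycle_length e a /\
       a %| \big[lcmn/1]_(b : D) dotdiv (h b) (val b)).
Proof.
have [s s_inj sP] := disjoint_union_of_cycles_succ He.
split=> [[f [f_hom f_rot]] h /fin_all_exists[x xP] | lcmP].
- set L := \big[lcmn/1]_b _.
  pose t : {ffun VD D -> V} :=
    [ffun v : {b : D & 'I_(val b)} => iter (L * tagged v) s (x (tag v))].
  have h_dvd b : h b %| L * val b.
    apply: dvdn_trans (dvdn_dotdiv_mul _ (val b)) _.
    by rewrite dvdn_mul // (biglcmn_sup b).
  have rot_t : rotation t = iter L (shift s) t.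
    apply/ffunP=> -[b k]; rewrite iter_shift !ffunE /= -iterD -mulnS.
    (* The index [k + 1] wraps around modulo [b]; the discarded multiple of [L * b] is harmless
       because [h b] divides [L * b]. *)
    rewrite [in RHS](divn_eq k.+1 (val b)) mulnDr addnC iterD.
    congr iter; apply/esym/eqP; rewrite (iter_dicycle_eq _ sP (xP b)).
    by rewrite mulnCA dvdn_mull.
  have f_shift n u : f (iter n (shift s) u) = iter n s (f u).
    elim: n => //= n <-; apply/eqP; rewrite -sP; apply: f_hom.
    by rewrite (power_edge_shift _ _ sP).
  (* The cycle through [f t] works: [f t = f (P t) = f (S^L t) = s^L (f t)], so its length divides
     [L]. *)
  have [a aP] := He.2 (f t); exists a; split; first by exists (f t).
  by rewrite -(iter_dicycle_eq L sP aP) -f_shift -rot_t -f_rot.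
- have fixP t : exists x, forall n m,
      iter n (@shift V D s) (iter m (@rotation V D) t) = t -> iter n s x = x.
    (* [v b] is the coordinate [(b, 0)], which exists since [b > 0]; [h b] is the length of the
       cycle through [t (v b)]. *)
    pose v b := Tagged (fun b : D => 'I_(val b)) (Ordinal (D_pos _ (valP b))).
    have /fin_all_exists[h hP] b := He.2 (t (v b)).
    have [a [[x xP] a_dvd]] := lcmP h (fun b => ex_intro _ (t (v b)) (hP b)).
    exists x => n m fix_t; apply/eqP; rewrite (iter_dicycle_eq _ sP xP).
    apply: dvdn_trans a_dvd _; apply/dvdn_biglcmP => b _.
    apply: dotdiv_dvdn; first by case: (hP b).
    rewrite -(iter_dicycle_eq _ sP (hP b)); apply/eqP.
    exact: shift_rotation_block fix_t.
  have [f fP] := exists_equivariant_map (shift_inj s_inj)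
    (@rotation_inj V D) (@shift_rotation V D s) fixP.
  exists f; split=> [t u | t]; last exact: esym (fP t).2.
  by rewrite (power_edge_shift _ _ sP) sP => /eqP->; rewrite (fP t).1.
Qed.
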